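(* Let $A$, $\Omega=\bigcup_{i=1}^m\Omega_i$, $\mathcal{E}$, $W$, $M$, $\widehat{A}$ be as defined in the context, and assume that $A$ and $-W$ are symmetric positive definite. Let $\Lambda\subset\mathbb{R}^{\mathcal{E}}$ be a subspace with $\dim(\Lambda)=r$ and let $Z\in\mathbb{R}^{|\mathcal{E}|\times r}$ satisfy $\mathrm{range}(Z)=\Lambda$. Let $$\mathcal{M}=\widehat{A}+4M^TWZ\left(Z^TWZ\right)^{-1}Z^TWM,\qquad E=I-\mathcal{M}^{-1}A,$$ $$\Pi_\Lambda=Z(Z^TWZ)^{-1}Z^TW,\qquad K_\Lambda=\max_{p\in\mathbb{R}^\Omega,\ p\neq0}\frac{4\|(I-\Pi_\Lambda)Mp\|_{-W}^2}{\|p\|_A^2}.$$ Then $$\|E\|_A\le\frac{K_\Lambda}{1+K_\Lambda}<1,$$ and moreover $$\kappa(\mathcal{M}^{-1}A)\le1+2K_\Lambda,$$ where $\kappa(\mathcal{M}^{-1}A)$ is the condition number of $\mathcal{M}^{-1}A$ in the $A$-norm.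
   Context: Let $A=(a_{kl})\in\mathbb{R}^{N\times N}$ be a symmetric matrix, with rows and columns indexed by $\Omega=\{1,\dots,N\}$. Let $\Omega=\bigcup_{i=1}^m\Omega_i$ be a partition into $m$ pairwise disjoint subsets (subdomains), with the indices ordered so that those of $\Omega_1,\Omega_2,\dots,\Omega_m$ are consecutive. $A_{ij}$ denotes the submatrix of $A$ with rows in $\Omega_i$ and columns in $\Omega_j$; for $i\ne j$ write $i\sim j$ if $A_{ij}\neq0$. For finite sets $X,Y$, $\mathbb{R}^X$ denotes real vectors indexed by $X$ and $\mathbb{R}^{X\times Y}$ real matrices with rows indexed by $X$ and columns by $Y$. Interface edges: $\mathcal{E}$ is the set of pairs $(k,l)$ with $k\in\Omega_i$, $l\in\Omega_j$ for some $i<j$ and $a_{kl}\ne0$. $W\in\mathbb{R}^{\mathcal{E}\times\mathcal{E}}$ is the diagonal matrix with entry $a_{kl}$ at $e=(k,l)\in\mathcal{E}$. The averaging matrix $M\in\mathbb{R}^{\mathcal{E}\times\Omega}$ is given by $(Mp)_e=\frac{p_k+p_l}{2}$ for $e=(k,l)\in\mathcal{E}$, $p\in\mathbb{R}^\Omega$. For $i\sim j$ let $D_{ij}=\mathrm{diag}(A_{ij}\mathbf{1}_{\Omega_j})$ (diagonal matrix indexed by $\Omega_i$ whose $k$-th diagonal entry is $\sum_{l\in\Omega_j}a_{kl}$), let $A_i=A_{ii}-\sum_{j:\,j\sim i}D_{ij}$, and let $\widehat{A}=\mathrm{diag}(A_1,\dots,A_m)\in\mathbb{R}^{\Omega\times\Omega}$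 (block diagonal). Norms: $\|p\|_A^2=p^TAp$ on $\mathbb{R}^\Omega$ and $\|\eta\|_{-W}^2=-\eta^TW\eta$ on $\mathbb{R}^{\mathcal{E}}$. For a matrix $X\in\mathbb{R}^{\Omega\times\Omega}$, $\|X\|_A$ is the operator norm induced by $\|\cdot\|_A$, and the condition number of an invertible $X$ in the $A$-norm is $\kappa(X)=\|X\|_A\|X^{-1}\|_A$. The matrix $\mathcal{M}$ is symmetric positive definite under the stated assumptions. *)

(* Defs.v *)
From HB Require Import structures.
From mathcomp Require Import all_boot all_order all_algebra.
From mathcomp Require Import boolp classical_sets reals.
Set Implicit Arguments.
Unset Strict Implicit.
Unset Printing Implicit Defensive.
Import Order.TTheory GRing.Theory Num.Theory.
Local Open Scope ring_scope.
Local Open Scope classical_set_scope.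

Section Norms.
Variable R : realType.

Definition qform n (B : 'M[R]_n) (p : 'cV[R]_n) : R := (p^T *m B *m p) 0 0.

Definition spd n (B : 'M[R]_n) : Prop :=
  B^T = B /\ forall p : 'cV[R]_n, p != 0 -> 0 < qform B p.

Definition mxnorm n (B : 'M[R]_n) (p : 'cV[R]_n) : R := Num.sqrt (qform B p).

Definition opnorm n (B X : 'M[R]_n) : R :=
  sup [set mxnorm B (X *m p) / mxnorm B p | p in [set p : 'cV[R]_n | p != 0]].

Definition condnum n (B X : 'M[R]_n) : R := opnorm B X * opnorm B (invmx X).

(* An attained maximum, not a supremum: the default value 0 is returned as
   soon as [S] has no greatest element. *)
Definition maximum (S : set R) : R := xget 0 [set x | S x /\ ubound S x].

End Norms.

(* The partition of the index set 'I_N into m subdomains is given by the map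
   [dom] sending an index to the number of its subdomain, so that Omega_i is
   [set k | dom k == i]. *)
Section Schwarz.
Variables (R : realType) (N m : nat) (A : 'M[R]_N) (dom : 'I_N -> 'I_m).

Definition neighbors (i j : 'I_m) : bool :=
  (i != j) &&
  [exists k, exists l, [&& dom k == i, dom l == j & A k l != 0]].

Definition edges : {set 'I_N * 'I_N} :=
  [set e | (dom e.1 < dom e.2)%N && (A e.1 e.2 != 0)]%SET.

(* Vectors and matrices over the edges are indexed by 'I_#|edges|, the edge
   with index e being [edge e]. *)
Definition edge (e : 'I_#|edges|) : 'I_N * 'I_N := enum_val e.

Definition weightmx : 'M[R]_#|edges| :=
  diag_mx (\row_e A (edge e).1 (edge e).2).

Definition avgmx : 'M[R]_(#|edges|, N) :=
  \matrix_(e, k) (((k == (edge e).1)%:R + (k == (edge e).2)%:R) / 2).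

(* The k-th diagonal entry of D_ij, for i = dom k. *)
Definition Dentry (j : 'I_m) (k : 'I_N) : R := \sum_(l | dom l == j) A k l.

Definition Ahat : 'M[R]_N :=
  \matrix_(k, l)
    if dom k == dom l then
      A k l - (if k == l then \sum_(j | neighbors j (dom k)) Dentry j k else 0)
    else 0.

Section Coarse.
Variables (r : nat) (Z : 'M[R]_(#|edges|, r)).

Definition precond : 'M[R]_N :=
  Ahat + 4 *: (avgmx^T *m weightmx *m Z *m invmx (Z^T *m weightmx *m Z)
               *m Z^T *m weightmx *m avgmx).

Definition errmx : 'M[R]_N := 1%:M - invmx precond *m A.

Definition projmx : 'M[R]_#|edges| :=
  Z *m invmx (Z^T *m weightmx *m Z) *m Z^T *m weightmx.

Definition Kconst : R :=
  maximum [set 4 * mxnorm (- weightmx) ((1%:M - projmx) *m (avgmx *m p)) ^+ 2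
               / mxnorm A p ^+ 2 | p in [set p : 'cV[R]_N | p != 0]].

End Coarse.
End Schwarz.

(* Main.v *)
(* One has [Ahat = A - 4 M^T W M], hence [precond = A + B] where
   [B = 4 M^T (-W) (I - Pi) M] is positive semidefinite, [I - Pi] being an
   orthogonal projector for the inner product of [-W]; so [K] is the best
   constant in [B <= K A]. In the inner product of [A], the matrices
   [E = (A + B)^-1 B], [(A + B)^-1 A] and [A^-1 (A + B)] are then self-adjoint,
   with quadratic forms between 0 and [K / (1 + K)], [1] and [1 + K] times that
   of [A]. By Cauchy-Schwarz these factors bound the operator norms, and the
   condition number is even at most [1 + K]. *)

Require Import Defs.
From HB Require Import structures.
From mathcomp Require Import all_boot all_order all_algebra.
From mathcomp Require Import boolp classical_sets reals.
From mathcomp Require Import ring lra.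
Set Implicit Arguments.
Unset Strict Implicit.
Unset Printing Implicit Defensive.
Import Order.TTheory GRing.Theory Num.Theory.
Local Open Scope ring_scope.

(** * Quadratic forms and Rayleigh quotients of symmetric matrices *)

Section Forms.
Variables (R : realType) (n : nat).
Implicit Types (A B C S T X : 'M[R]_n) (p q : 'cV[R]_n).

Definition bform B p q : R := (p^T *m B *m q) 0 0.

Definition psd B : Prop := B^T = B /\ forall p, 0 <= qform B p.

Lemma exists_neq0 : (0 < n)%N -> exists v : 'cV[R]_n, v != 0.
Proof.
move=> n0; exists (const_mx 1).
apply/eqP => /matrixP /(_ (Ordinal n0) 0); rewrite !mxE; exact/eqP/oner_neq0.
Qed.

Lemma bformC B p q : B^T = B -> bform B p q = bform B q p.
Proof.
move=> Bs; have -> : bform B q p = (p^T *m B *m q)^T 0 0.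
  by rewrite !trmx_mul trmxK Bs mulmxA.
by rewrite mxE.
Qed.

Lemma bformE B p q : bform B p q = \sum_i \sum_j p i 0 * B i j * q j 0.
Proof.
rewrite /bform mxE exchange_big; apply: eq_bigr => j _ /=.
rewrite mxE big_distrl /=; apply: eq_bigr => i _; by rewrite mxE.
Qed.

Lemma bformDl B p p' q : bform B (p + p') q = bform B p q + bform B p' q.
Proof. by rewrite /bform linearD /= !mulmxDl mxE. Qed.

Lemma bformDr B p q q' : bform B p (q + q') = bform B p q + bform B p q'.
Proof. by rewrite /bform mulmxDr mxE. Qed.

Lemma bformZl B a p q : bform B (a *: p) q = a * bform B p q.
Proof. by rewrite /bform linearZ /= -!scalemxAl mxE. Qed.

Lemma bformZr B a p q : bform B p (a *: q) = a * bform B p q.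
Proof. by rewrite /bform -scalemxAr mxE. Qed.

Lemma qformD A B p : qform (A + B) p = qform A p + qform B p.
Proof. by rewrite /qform mulmxDr mulmxDl mxE. Qed.

Lemma qformN A p : qform (- A) p = - qform A p.
Proof. by rewrite /qform mulmxN mulNmx mxE. Qed.

Lemma qformZ a A p : qform (a *: A) p = a * qform A p.
Proof. by rewrite /qform -scalemxAr -scalemxAl mxE. Qed.

Lemma qform0 A : qform A 0 = 0.
Proof. by rewrite /qform mulmx0 mxE. Qed.

Lemma qform_comb B a b p q : B^T = B ->
  qform B (a *: p + b *: q) =
  a ^+ 2 * qform B p + 2 * a * b * bform B p q + b ^+ 2 * qform B q.
Proof.
move=> Bs; rewrite -[qform B (_ + _)]/(bform B _ _) bformDl !bformDr !bformZl !bformZr.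
rewrite (bformC q p Bs) /qform -!/(bform _ _ _); ring.
Qed.

Lemma spd_psd A : spd A -> psd A.
Proof.
case=> As Ap; split=> // p; have [->|/Ap/ltW//] := eqVneq p 0.
by rewrite qform0.
Qed.

Lemma spdD A B : spd A -> psd B -> spd (A + B).
Proof.
move=> [As Ap] [Bs Bp]; split; first by rewrite linearD /= As Bs.
by move=> p /Ap p0; rewrite qformD ltr_wpDr.
Qed.

Lemma cauchy_schwarz B p q : psd B ->
  bform B p q ^+ 2 <= qform B p * qform B q.
Proof.
move=> [Bs Bp].
have H a b := Bp (a *: p + b *: q).
have := Bp q; rewrite le_eqVlt => /orP[/eqP q0|q0].
  have := Bp p; rewrite le_eqVlt => /orP[/eqP p0|p0].
    (* When the form vanishes at both [p] and [q], its value at [p - t q] with [t = bform B p q] is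
       [- 2 t ^+ 2]. *)
    have := H 1 (- bform B p q); rewrite qform_comb // -p0 -q0 => h; nra.
  have := H (- bform B p q) (qform B p); rewrite qform_comb // -q0 => h.
  rewrite mulr0 -(pmulr_rle0 _ p0); nra.
(* The form at this combination is [qform B q] times the difference of the two sides. *)
have := H (qform B q) (- bform B p q); rewrite qform_comb // => h.
rewrite -subr_ge0 -(pmulr_rge0 _ q0); apply: le_trans h _; rewrite le_eqVlt.
apply/orP; left; apply/eqP; ring.
Qed.

Lemma spd_unitmx A : spd A -> A \in unitmx.
Proof.
move=> [As Ap]; rewrite -unitmx_tr -row_free_unit -kermx_eq0.
apply/rowV0P => v /sub_kermxP vA0; apply/eqP/contraT => v0.
have /Ap : v^T != 0 by rewrite -(inj_eq trmx_inj) trmxK trmx0.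
by rewrite /qform trmxK -{1}As vA0 mul0mx mxE ltxx.
Qed.

Lemma trmx_invmx_sym A : A^T = A -> (invmx A)^T = invmx A.
Proof. by move=> As; rewrite trmx_inv As. Qed.

Lemma invmx_uniq A B : A *m B = 1%:M -> invmx A = B.
Proof.
move=> AB1; have [Au _] := mulmx1_unit AB1.
by rewrite -[RHS]mul1mx -(mulVmx Au) -mulmxA AB1 mulmx1.
Qed.

(** The [i]-th coordinate is the [C]-inner product with [C^-1 e_i], so Cauchy-Schwarz bounds it. *)
Lemma coord_le_spd C i : spd C ->
  exists2 c, 0 <= c & forall p, p i 0 ^+ 2 <= c * qform C p.
Proof.
move=> Cspd; have Cu := spd_unitmx Cspd; have Cpsd := spd_psd Cspd.
pose u : 'cV[R]_n := invmx C *m delta_mx i 0.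
exists (qform C u); first by case: Cpsd.
move=> p; suff -> : p i 0 = bform C u p by exact: cauchy_schwarz.
rewrite /bform trmx_mul (trmx_invmx_sym Cspd.1) -(mulmxA _ _ C) mulVmx //.
by rewrite mulmx1 trmx_delta -rowE mxE.
Qed.

(** Each term [S i j * p i * p j] is controlled by the squares of two coordinates; the explicit
    constant replaces a compactness argument. *)
Lemma form_le_spd C S : spd C ->
  exists2 c, 0 < c & forall p, qform S p <= c * qform C p.
Proof.
move=> Cspd.
have /choice [c cP] i : exists c, 0 <= c /\ forall p, p i 0 ^+ 2 <= c * qform C p.
  by have [c c0 cP] := coord_le_spd i Cspd; exists c.
pose b := \sum_i \sum_j `|S i j| * (c i + c j).
have b0 : 0 <= b.
  apply: sumr_ge0 => i _; apply: sumr_ge0 => j _; rewrite mulr_ge0 //.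
  by rewrite addr_ge0 //; [case: (cP i)|case: (cP j)].
(* Adding 1 makes the constant positive, so that it can be inverted. *)
exists (b + 1) => [|p]; first by rewrite ltr_wpDl.
have [_ /(_ p) Cp] := spd_psd Cspd.
apply: (@le_trans _ _ (b * qform C p)); last by rewrite ler_wpM2r // lerDl.
rewrite [qform S p]bformE big_distrl; apply: ler_sum => i _ /=.
rewrite big_distrl; apply: ler_sum => j _ /=.
have [_ /(_ p) ip] := cP i; have [_ /(_ p) jp] := cP j.
apply: le_trans (ler_norm _) _.
rewrite !normrM mulrAC mulrC -mulrA ler_wpM2l // mulrDl.
have := sqr_ge0 (`|p i 0| - `|p j 0|); rewrite sqrrB !real_normK ?num_real //.
have := mulr_ge0 (normr_ge0 (p i 0)) (normr_ge0 (p j 0)).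
move: ip jp; lra.
Qed.

(* If the supremum [x] of the Rayleigh quotient were not attained, then
   [x A - B] would be positive definite, hence dominate a positive multiple
   of [A], and a smaller upper bound would exist. *)
Lemma rayleigh_max A B : (0 < n)%N -> spd A -> B^T = B ->
  exists2 p, p != 0 & forall q, q != 0 ->
    qform B q / qform A q <= qform B p / qform A p.
Proof.
move=> n0 Aspd Bs; have [As Ap] := Aspd.
pose S := [set qform B p / qform A p | p in [set p : 'cV[R]_n | p != 0]]%classic.
have [c c0 cP] := form_le_spd B Aspd.
have Sne : (S !=set0)%classic.
  by have [v v0] := exists_neq0 n0; exists (qform B v / qform A v), v.
have Sub : has_ubound S.
  by exists c => _ [p /= p0 <-]; rewrite ler_pdivrMr ?Ap.
pose x := sup S.
have le_x q : q != 0 -> qform B q / qform A q <= x.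
  by move=> q0; apply: ub_le_sup => //; exists q.
have [[p p0 px]|noteq] := pselect (exists2 p, p != 0 & qform B p / qform A p = x).
  by exists p => // q /le_x; rewrite px.
have Cspd : spd (x *: A - B).
  split; first by rewrite linearB linearZ /= As Bs.
  move=> p p0; rewrite qformD qformN qformZ subr_gt0 -ltr_pdivrMr ?Ap //.
  rewrite lt_neqAle le_x // andbT; apply/eqP => px; apply: noteq; by exists p.
have [d d0 dP] := form_le_spd A Cspd.
suff : x <= x - d^-1 by rewrite lerBrDr gerDl leNgt invr_gt0 d0.
apply: ge_sup => // _ [p /= p0 <-]; rewrite ler_pdivrMr ?Ap // mulrBl.
have := dP p; rewrite qformD qformN qformZ -ler_pdivrMl //; lra.
Qed.

(** * Norms and operator norms for the inner product of [A] *)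

Lemma mxnorm_ge0 A p : 0 <= mxnorm A p.
Proof. exact: sqrtr_ge0. Qed.

Lemma mxnorm_gt0 A p : spd A -> p != 0 -> 0 < mxnorm A p.
Proof. by move=> [_ Ap] /Ap; rewrite sqrtr_gt0. Qed.

Lemma sqr_mxnorm A p : psd A -> mxnorm A p ^+ 2 = qform A p.
Proof. by move=> [_ Ap]; rewrite sqr_sqrtr. Qed.

Lemma opnorm_ge0 A X : 0 <= opnorm A X.
Proof.
rewrite /opnorm; set S := (X in sup X).
(* [sup] is 0 by convention for a set without a supremum. *)
have [Sup|/sup_out -> //] := pselect (has_sup S).
case: Sup => -[y [p p0 py]] Sub.
apply: (@le_trans _ _ y); first by rewrite -py divr_ge0 ?mxnorm_ge0.
by apply: ub_le_sup => //; exists p.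
Qed.

(* Cauchy-Schwarz for the form [A X], applied to [p] and [X p]. *)
Lemma opnorm_le A X c : (0 < n)%N -> spd A -> psd (A *m X) ->
  (forall p, qform (A *m X) p <= c * qform A p) -> opnorm A X <= c.
Proof.
move=> n0 Aspd [Ts Tp] Tc.
have Apsd := spd_psd Aspd.
have c0 p : p != 0 -> 0 <= c.
  move=> p0; have := le_trans (Tp p) (Tc p).
  by rewrite pmulr_lge0 // (Aspd.2 p p0).
apply: ge_sup.
  have [v v0] := exists_neq0 n0.
  by exists (mxnorm A (X *m v) / mxnorm A v), v.
move=> _ [p /= p0 <-]; rewrite ler_pdivrMr ?mxnorm_gt0 //.
set q := X *m p.
have qE : bform (A *m X) q p = qform A q.
  by rewrite /bform /qform -!mulmxA.
have := cauchy_schwarz q p (conj Ts Tp); rewrite qE => cs.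
(* Both factors are bounded through [c]; afterwards one factor [qform A q] cancels unless it
   vanishes. *)
have h : qform A q ^+ 2 <= c ^+ 2 * qform A p * qform A q.
  apply: le_trans cs _.
  apply: le_trans (ler_pM (Tp q) (Tp p) (Tc q) (Tc p)) _.
  rewrite le_eqVlt; apply/orP; left; apply/eqP; ring.
have h2 : qform A q <= c ^+ 2 * qform A p.
  have := Apsd.2 q; rewrite le_eqVlt => /orP[/eqP <-|q0].
    by rewrite mulr_ge0 ?sqr_ge0 ?Apsd.2.
  by rewrite -(ler_pM2r q0) -expr2.
rewrite -ler_sqr ?nnegrE ?mulr_ge0 ?mxnorm_ge0 ?(c0 p) //.
by rewrite exprMn !sqr_mxnorm.
Qed.

(** * Splittings [P = A + B] with [B] between 0 and [K A] *)

Section Pencil.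
Variables (A B : 'M[R]_n) (K : R).
Hypotheses (n_gt0 : (0 < n)%N) (A_spd : spd A) (B_psd : psd B) (K_ge0 : 0 <= K).
Hypothesis B_le : forall p, qform B p <= K * qform A p.

Let P := A + B.
(** The matrix of the form of [P^-1 A] in the inner product of [A]. *)
Let T := A *m (invmx P *m A).

Let P_spd : spd P. Proof. exact: spdD. Qed.

Let P_unit : P \in unitmx. Proof. exact: spd_unitmx. Qed.

Let T_sym : T^T = T.
Proof.
by rewrite /T !trmx_mul (trmx_invmx_sym P_spd.1) A_spd.1 mulmxA.
Qed.

Let qformT p : qform T p = qform P (invmx P *m A *m p).
Proof.
rewrite /qform /T !trmx_mul (trmx_invmx_sym P_spd.1) A_spd.1 -!mulmxA.
by rewrite (mulmxA P) mulmxV // mul1mx.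
Qed.

Let T_ge0 p : 0 <= qform T p.
Proof. by rewrite qformT (spd_psd P_spd).2. Qed.

(** Write [A(p)] for [qform A p]. With [u = P^-1 A p], Cauchy-Schwarz for [A] gives
    [T(p)^2 <= A(p) A(u)], and [A(u) <= P(u) = T(p)]. *)
Let T_le p : qform T p <= qform A p.
Proof.
set u := invmx P *m A *m p.
have uE : bform A p u = qform T p by rewrite /bform /qform /u /T !mulmxA.
have := cauchy_schwarz p u (spd_psd A_spd); rewrite uE => cs.
have uP : qform A u <= qform T p by rewrite qformT -/u qformD lerDl B_psd.2.
have := T_ge0 p; rewrite le_eqVlt => /orP[/eqP <-|t0].
  by rewrite (spd_psd A_spd).2.
rewrite -(ler_pM2r t0) -expr2; apply: le_trans cs _.
by rewrite ler_wpM2l // (spd_psd A_spd).2.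
Qed.

(** The same [u] in Cauchy-Schwarz for [P] gives [A(p)^2 <= P(p) T(p)], and
    [P(p) <= (1 + K) A(p)]. *)
Let T_ge p : qform A p <= (1 + K) * qform T p.
Proof.
set u := invmx P *m A *m p.
have uE : bform P p u = qform A p.
  by rewrite /bform /qform /u -!mulmxA (mulmxA P) mulmxV // mul1mx.
have := cauchy_schwarz p u (spd_psd P_spd); rewrite uE -qformT => cs.
have pP : qform P p <= (1 + K) * qform A p.
  by rewrite qformD mulrDl mul1r lerD2l.
have := (spd_psd A_spd).2 p; rewrite le_eqVlt => /orP[/eqP <-|a0].
  by rewrite mulr_ge0 // addr_ge0.
rewrite -(ler_pM2r a0) -expr2; apply: le_trans cs _.
by rewrite mulrAC ler_wpM2r.
Qed.

(** The form of the error matrix is [A - T]; the two bounds on [T] place it between 0 and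
    [K / (1 + K)] times [A]. *)
Lemma opnorm_splitting_err : opnorm A (1%:M - invmx (A + B) *m A) <= K / (1 + K).
Proof.
have K1 : 0 < 1 + K by rewrite ltr_wpDr.
have AE : A *m (1%:M - invmx P *m A) = A - T by rewrite mulmxBr mulmx1.
apply: opnorm_le => //; rewrite -/P AE.
  split; first by rewrite linearB /= A_spd.1 T_sym.
  by move=> p; rewrite qformD qformN subr_ge0.
move=> p; rewrite qformD qformN mulrAC ler_pdivlMr //.
have := T_ge p; lra.
Qed.

(** The forms of [P^-1 A] and of its inverse [A^-1 P] are [T <= A] and [P <= (1 + K) A]. *)
Lemma condnum_splitting : condnum A (invmx (A + B) *m A) <= 1 + K.
Proof.
have A_unit := spd_unitmx A_spd.
rewrite /condnum -[leRHS]mul1r; apply: ler_pM; rewrite ?opnorm_ge0 //.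
  by apply: opnorm_le => // p; rewrite mul1r.
have -> : invmx (invmx P *m A) = invmx A *m P.
  apply: invmx_uniq; rewrite mulmxA -(mulmxA _ A) mulmxV // mulmx1.
  exact: mulVmx.
have AE : A *m (invmx A *m P) = P by rewrite mulmxA mulmxV // mul1mx.
apply: opnorm_le => //; rewrite -/P AE; first exact: spd_psd.
by move=> p; rewrite qformD mulrDl mul1r lerD2l.
Qed.

End Pencil.
End Forms.

(** * The [W]-orthogonal projector onto the range of [Z] *)

Section Projection.
Variables (R : realType) (n r : nat) (W : 'M[R]_n) (Z : 'M[R]_(n, r)).

(** The form of [- W] pulled back along the injective [Z] stays positive definite; the sign does not
    affect invertibility. *)
Lemma gram_unitmx : spd (- W) -> (forall c : 'cV[R]_r, Z *m c = 0 -> c = 0) ->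
  Z^T *m W *m Z \in unitmx.
Proof.
move=> [Vs Vp] Zinj; suff : spd (- (Z^T *m W *m Z)).
  by move/spd_unitmx; rewrite -scaleN1r unitmxZ ?unitrN1.
rewrite -mulNmx -mulmxN; split; first by rewrite !trmx_mul trmxK Vs mulmxA.
move=> c c0; have -> : qform (Z^T *m - W *m Z) c = qform (- W) (Z *m c).
  by rewrite /qform trmx_mul !mulmxA.
by apply: Vp; apply/eqP => /Zinj /eqP; apply/negP.
Qed.

Let Q := 1%:M - Z *m invmx (Z^T *m W *m Z) *m Z^T *m W.

(** [Q] is self-adjoint for [W], and idempotent because [Z^T W Q = 0]. *)
Lemma coprojection_form : W^T = W -> Z^T *m W *m Z \in unitmx ->
  Q^T *m W *m Q = W *m Q.
Proof.
move=> Ws Su; set S := Z^T *m W *m Z in Su *.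
have Ss : S^T = S by rewrite /S !trmx_mul trmxK Ws mulmxA.
have QW : Q^T *m W = W *m Q.
  rewrite /Q -/S linearB /= trmx1 mulmxBl mulmxBr mul1mx mulmx1.
  by rewrite !trmx_mul trmxK Ws (trmx_invmx_sym Ss) !mulmxA.
have ZQ : Z^T *m W *m Q = 0.
  rewrite /Q -/S mulmxBr mulmx1 !mulmxA -/S mulmxV // mul1mx; exact: subrr.
rewrite QW -mulmxA; congr (_ *m _).
by rewrite {1}/Q -/S mulmxBl mul1mx -!mulmxA (mulmxA Z^T) ZQ !mulmx0 subr0.
Qed.

End Projection.

(** Rank-nullity: [Z] maps a space of dimension [r] onto one of dimension [r]. *)
Lemma mulmx_inj_of_dim (F : fieldType) n r (U : {vspace 'cV[F]_n})
    (Z : 'M[F]_(n, r)) :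
  \dim U = r ->
  (forall v : 'cV[F]_n, v \in U <-> exists c : 'cV[F]_r, v = Z *m c) ->
  forall c : 'cV[F]_r, Z *m c = 0 -> c = 0.
Proof.
move=> dimU UE c Zc0; pose f : 'Hom('cV[F]_r, 'cV[F]_n) := linfun (mulmx Z).
have fE x : f x = Z *m x by rewrite lfunE.
have imf : (f @: {:'cV[F]_r} = U)%VS.
  apply/vspaceP => v; apply/memv_imgP/idP => [[x _ ->]|/UE[x ->]].
    by apply/UE; exists x; rewrite fE.
  by exists x; rewrite ?memvf ?fE.
have := limg_ker_dim f {:'cV[F]_r}.
have -> : \dim {:'cV[F]_r} = r by rewrite dimvf; exact: muln1.
rewrite imf dimU capfv => /eqP.
rewrite -[X in _ == X]add0n eqn_add2r dimv_eq0 => /lker0P finj.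
by apply: finj; rewrite !fE Zc0 mulmx0.
Qed.

(** * [Ahat] and the preconditioner as perturbations of [A] *)

Section Splitting.
Variables (R : realType) (N m : nat) (A : 'M[R]_N) (dom : 'I_N -> 'I_m).
Hypothesis A_sym : A^T = A.

Let A_symE k l : A k l = A l k. Proof. by rewrite -{1}A_sym mxE. Qed.

Lemma sum_delta (F : 'I_N -> R) k : \sum_i (k == i)%:R * F i = F k.
Proof.
rewrite (bigD1 k) //= eqxx mul1r big1 ?addr0 // => i.
by rewrite eq_sym => /negPf ->; rewrite mul0r.
Qed.

(** A subdomain that is not a neighbor contributes only zero entries. Symmetry enters since
    [neighbors] tests the block with rows in [j], whereas [Dentry] sums over the transposed
    block. *)
Lemma sum_neighbors k :
  \sum_(j | neighbors A dom j (dom k)) Dentry A dom j k =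
  \sum_(l | dom l != dom k) A k l.
Proof.
rewrite [RHS](partition_big dom (fun j => j != dom k)) //=.
rewrite big_mkcond [RHS]big_mkcond; apply: eq_bigr => j _ /=.
rewrite /neighbors; have [->//|jk /=] := eqVneq j (dom k).
have DE : Dentry A dom j k = \sum_(l | (dom l != dom k) && (dom l == j)) A k l.
  apply: eq_bigl => l; have [->|] := eqVneq (dom l) j; first by rewrite jk.
  by rewrite andbF.
case: ifPn => [_|/existsPn nex]; first exact: DE.
rewrite big1 // => l /andP[_ lj]; apply/eqP/contraT => a0.
have /existsPn /(_ k) := nex l; by rewrite lj eqxx A_symE a0.
Qed.

(** An edge [(i, j)] adds [a_ij (e_i + e_j) (e_i + e_j)^T] to [4 M^T W M]: the off-diagonal parts
    rebuild the interface blocks of [A], the diagonal parts the row sums in the [D_ij]. *)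
Lemma Ahat_splitting :
  Ahat A dom = A - 4 *: ((avgmx A dom)^T *m weightmx A dom *m avgmx A dom).
Proof.
apply/matrixP => k l.
(* Edge weights extended by zero to all ordered pairs, so that sums over edges become double
   sums. *)
pose b i j := if (dom i < dom j)%N then A i j else 0.
have bD i j : b i j + b j i = if dom i != dom j then A i j else 0.
  rewrite /b (A_symE j i) -val_eqE /=.
  by case: ltngtP => _; rewrite ?addr0 ?add0r.
have -> : Ahat A dom k l = A k l - (if dom k != dom l then A k l else 0)
    - (k == l)%:R * \sum_(j | dom j != dom k) A k j.
  rewrite mxE sum_neighbors; case: (eqVneq (dom k) (dom l)) => [_|kl] /=.
    by rewrite subr0; case: eqP => _; rewrite ?mul1r ?mul0r.
  have [kl'|_] := eqVneq k l; first by rewrite kl' eqxx in kl.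
  by rewrite subrr mul0r subr0.
have -> : \sum_(j | dom j != dom k) A k j = \sum_j b k j + \sum_j b j k.
  rewrite -big_split big_mkcond /=; apply: eq_bigr => j _.
  by rewrite bD eq_sym.
suff E : (4 *: ((avgmx A dom)^T *m weightmx A dom *m avgmx A dom)) k l =
  \sum_i \sum_j ((k == i)%:R + (k == j)%:R) * ((l == i)%:R + (l == j)%:R) * b i j.
  rewrite mxE [(- _ : 'M_N) k l]mxE {}E -bD.
  (* Expanding the product gives two diagonal and two off-diagonal contributions. *)
  have -> : \sum_i \sum_j ((k == i)%:R + (k == j)%:R) * ((l == i)%:R + (l == j)%:R) * b i j
    = \sum_i (k == i)%:R * ((l == i)%:R * \sum_j b i j)
    + \sum_i (k == i)%:R * (\sum_j (l == j)%:R * b i j)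
    + \sum_i (l == i)%:R * (\sum_j (k == j)%:R * b i j)
    + \sum_j (k == j)%:R * ((l == j)%:R * \sum_i b i j).
    have -> : \sum_j (k == j)%:R * ((l == j)%:R * \sum_i b i j) =
      \sum_i \sum_j (k == j)%:R * ((l == j)%:R * b i j).
      rewrite exchange_big; apply: eq_bigr => j _ /=.
      by rewrite !big_distrr.
    rewrite -!big_split; apply: eq_bigr => i _ /=.
    rewrite !big_distrr -!big_split; apply: eq_bigr => j _ /=; ring.
  rewrite !sum_delta (eq_sym l k); ring.
rewrite mxE mul_mx_diag mxE big_distrr /=.
rewrite pair_bigA /=.
(* Pairs that are not edges contribute zero through [b]; the others are enumerated as edges. *)
rewrite [RHS](bigID (fun x => x \in edges A dom)) /= [X in _ = _ + X]big1 ?addr0.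
  rewrite [RHS]big_enum_val; apply: eq_bigr => e _.
  rewrite !mxE /edge /b; have := enum_valP e; rewrite inE => /andP[-> _].
  by field.
move=> x; rewrite inE negb_and negbK /b.
by case: ltnP => //= _; [move/eqP->|]; rewrite mulr0.
Qed.

(** The [- W] left over from [Ahat] and the coarse term [W Pi] combine into [- W (I - Pi)]. *)
Lemma precond_splitting r (Z : 'M[R]_(#|edges A dom|, r)) :
  precond Z = A + 4 *: ((avgmx A dom)^T *m (- weightmx A dom)
    *m (1%:M - projmx Z) *m avgmx A dom).
Proof.
rewrite /precond Ahat_splitting -addrA -scalerN -scalerDr /projmx.
congr (_ + _ *: _); rewrite !(mulmxN, mulNmx, mulmxBr, mulmxBl) mulmx1 !mulmxA.
by rewrite opprK.
Qed.

End Splitting.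

Theorem theorem5p6 (R : realType) (N m r : nat) (N_gt0 : (0 < N)%N)
    (A : 'M[R]_N) (dom : 'I_N -> 'I_m)
    (dom_ordered : forall k l : 'I_N, (k <= l)%N -> (dom k <= dom l)%N)
    (A_spd : spd A) (W_spd : spd (- weightmx A dom))
    (Lambda : {vspace 'cV[R]_#|edges A dom|}) (dim_Lambda : \dim Lambda = r)
    (Z : 'M[R]_(#|edges A dom|, r))
    (range_Z : forall eta : 'cV[R]_#|edges A dom|,
        eta \in Lambda <-> exists c : 'cV[R]_r, eta = Z *m c) :
  let E := errmx Z in
  let K := Kconst Z in
  opnorm A E <= K / (1 + K) /\ K / (1 + K) < 1 /\
  condnum A (invmx (precond Z) *m A) <= 1 + 2 * K.
Proof.
move=> E K.
have Zinj := mulmx_inj_of_dim dim_Lambda range_Z.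
have Wu := gram_unitmx W_spd Zinj.
pose M := avgmx A dom; pose W := weightmx A dom; pose Q := 1%:M - projmx Z.
have Ws : W^T = W by rewrite /W tr_diag_mx.
pose B := 4 *: (M^T *m (- W) *m Q *m M).
(* In this symmetric form [B] is visibly positive semidefinite. *)
have BE : B = 4 *: ((Q *m M)^T *m (- W) *m (Q *m M)).
  rewrite /B !mulmxN !mulNmx -(mulmxA _ W) -(coprojection_form Ws Wu).
  by rewrite trmx_mul !mulmxA.
have qB p : qform B p = 4 * mxnorm (- W) (Q *m (M *m p)) ^+ 2.
  rewrite sqr_mxnorm; last exact: spd_psd.
  by rewrite BE qformZ /qform !trmx_mul !mulmxA.
have B_psd : psd B.
  split; last by move=> p; rewrite qB mulr_ge0 ?sqr_ge0 ?ler0n.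
  rewrite BE; move: (Q *m M) => C.
  by rewrite linearZ /= !trmx_mul trmxK W_spd.1 mulmxA.
have ratioE p : 4 * mxnorm (- W) (Q *m (M *m p)) ^+ 2 / mxnorm A p ^+ 2 =
    qform B p / qform A p.
  by rewrite -qB sqr_mxnorm //; exact: spd_psd.
have [p p0 [pK K_ub]] : exists2 p : 'cV[R]_N, p != 0 &
    qform B p / qform A p = K /\
    forall q : 'cV[R]_N, q != 0 -> qform B q / qform A q <= K.
  (* The Rayleigh quotient attains its maximum, so [maximum] does not fall back on its default value
     0. *)
  have [p p0 pmax] := rayleigh_max N_gt0 A_spd B_psd.1.
  rewrite /K /Kconst /maximum; set S := (X in xget 0 X).
  have [|[q /= q0 <-] Sub] := @xgetPex _ 0 S.
    exists (qform B p / qform A p); split; first by exists p => //; exact: ratioE.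
    by move=> _ [q /= q0 <-]; rewrite ratioE pmax.
  exists q => //; split; first by rewrite -ratioE.
  by move=> q' q'0; apply: Sub; exists q' => //; exact: ratioE.
have K_ge0 : 0 <= K by rewrite -pK divr_ge0 ?B_psd.2 ?(spd_psd A_spd).2.
have K_bound q : qform B q <= K * qform A q.
  have [->|q0] := eqVneq q 0; first by rewrite !qform0 mulr0.
  by rewrite -ler_pdivrMr ?A_spd.2 // K_ub.
rewrite /E /errmx (precond_splitting A_spd.1) -/B; split.
  exact: opnorm_splitting_err.
split; first by rewrite ltr_pdivrMr ?ltr_wpDr // mul1r ltrDr.
apply: le_trans (condnum_splitting N_gt0 A_spd B_psd K_bound) _.
by rewrite lerD2l ler_peMl // ler1n.
Qed.
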